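(* Let $R$ be a ring and let $M$ be a nonzero virtually semisimple left $R$-module. Then the following conditions are equivalent. (1) $M$ is finitely generated. (2) $M$ is Noetherian. (3) $\mathrm{u.dim}(M)<+\infty$. (4) $M\cong R/P_1\oplus\cdots\oplus R/P_n$ for some $n\in\mathbb{N}$, where each $P_i$ is a quasi prime left ideal of $R$ such that $R/P_i$ is a critical Noetherian left $R$-module. Moreover, if $M$ satisfies any one (equivalently, all) of the conditions (1), (2), (3), (4), then $M\cong N$ for every essential submodule $N$ of $M$.
   Context: All rings are associative with identity and all modules are unitary left modules. A module $M$ is virtually semisimple if each submodule of $M$ is isomorphic to a direct summand of $M$. A submodule $N$ of $M$ is essential if $N$ has nonzero intersection with every nonzero submodule of $M$. A (nonzero) module is uniform if any two nonzero submodules have nonzero intersection. The uniform (Goldie) dimension $\mathrm{u.dim}(M)$ is $n$ if there are uniform submodules $U_1,\dots,U_n$ of $M$ whose sum is direct and is an essential submodule of $M$, and is infinite if no such finite set exists. A left ideal $P$ of $R$ is quasi prime if $P\neq R$ and, for all two-sided ideals $A,B$ of $R$, $AB\subseteq P\subseteq A\cap B$ implies $A\subseteq P$ or $B\subseteq P$. $\mathrm{K.dim}(M)$ denotes the (Gabriel–Rentschler) Krull dimension of a module, defined by transfinite recursion: $\mathrm{K.dim}(0)=-1$; and for an ordinal $\alpha\ge 0$, $\mathrm{K.dim}(M)=\alpha$ if $\mathrm{K.dim}(M)$ is not $<\alpha$ and, for every descending chain $M_0\supseteq M_1\supseteq\cdots$ of submodules of $M$, $\mathrm{K.dim}(M_i/M_{i+1})<\alpha$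 for all but finitely many $i$ (it may fail to exist). For an ordinal $\alpha\geq 0$, a module $M$ is $\alpha$-critical if $\mathrm{K.dim}(M)=\alpha$ and $\mathrm{K.dim}(M/N)<\alpha$ for every nonzero submodule $N$ of $M$; $M$ is critical if it is $\alpha$-critical for some ordinal $\alpha\ge 0$. *)

(* Defs.v *)
From HB Require Import structures.
From mathcomp Require Import all_boot all_order all_algebra.
From mathcomp Require Import boolp.

Set Implicit Arguments.
Unset Strict Implicit.
Unset Printing Implicit Defensive.

Import GRing.Theory.
Local Open Scope ring_scope.
Local Open Scope quotient_scope.

(* Rings are [pzRingType] (associative, with 1, possibly trivial), left modules
   are [lmodType R], and the submodules of [M] are the [N : submodClosed M].
   The latter are boolean predicates; by [boolp.asbool] every Prop-valued
   predicate is of this form, so no submodule is lost. *)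

Section Modules.
Variable R : pzRingType.
Implicit Types U V M : lmodType R.

Definition lmod_iso U V : Prop := exists f : {linear U -> V}, bijective f.

Definition nonzero_mod M : Prop := exists x : M, x != 0.

Section Submodule.
Variable M : lmodType R.
Implicit Types N K L : submodClosed M.

Lemma submodN N (x : M) : (- x \in N) = (x \in N).
Proof.
suff H (y : M) : y \in N -> - y \in N.
  by apply/idP/idP => /H //; rewrite opprK.
by rewrite -scaleN1r; apply: rpredZ.
Qed.

Definition nonzero_submod N : Prop := exists2 x : M, x \in N & x != 0.

Definition submod N : Type := {x : M | x \in N}.

HB.instance Definition _ N := SubType.on (submod N).
HB.instance Definition _ N := Choice.on (submod N).
HB.instance Definition _ N :=
  [SubChoice_isSubLmodule of submod N by <:].

Definition inter_submod N L : {pred submod N} := fun x => val x \in L.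

Fact inter_submod_closed N L : submod_closed (@inter_submod N L).
Proof.
split=> [|a x y]; rewrite ![_ \in inter_submod _]unfold_in /inter_submod.
  by rewrite raddf0 rpred0.
by rewrite linearP => xL yL; apply: rpredD yL; apply: rpredZ.
Qed.
HB.instance Definition _ N L :=
  GRing.isSubmodClosed.Build R (submod N) (@inter_submod N L)
    (@inter_submod_closed N L).

Definition sum_submod n (U : 'I_n -> submodClosed M) : {pred M} := fun v =>
  `[< exists2 x : 'I_n -> M, (forall i, x i \in U i) & v = \sum_i x i >].

Fact sum_submod_closed n (U : 'I_n -> submodClosed M) :
  submod_closed (sum_submod U).
Proof.
split=> [|a u v]; rewrite !unfold_in /sum_submod.
  by apply/asboolP; exists (fun=> 0) => [i|]; [apply: rpred0 | rewrite big1].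
move=> /asboolP[x xU ->] /asboolP[y yU ->]; apply/asboolP.
exists (fun i => a *: x i + y i) => [i|].
  by apply: rpredD (yU i); apply: rpredZ.
by rewrite scaler_sumr big_split.
Qed.
HB.instance Definition _ n (U : 'I_n -> submodClosed M) :=
  GRing.isSubmodClosed.Build R M (sum_submod U) (sum_submod_closed U).

Definition independent n (U : 'I_n -> submodClosed M) : Prop :=
  forall x : 'I_n -> M, (forall i, x i \in U i) ->
    \sum_i x i = 0 -> forall i, x i = 0.

Definition meets N L : Prop := exists x : M, [/\ x \in N, x \in L & x != 0].

Definition essential N : Prop := forall L, nonzero_submod L -> meets N L.

Definition direct_summand K : Prop :=
  exists L, (forall x : M, exists k l, [/\ k \in K, l \in L & x = k + l])
         /\ (forall x : M, x \in K -> x \in L -> x = 0).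

End Submodule.

Definition virtually_semisimple M : Prop :=
  forall N : submodClosed M,
    exists2 K : submodClosed M, direct_summand K & lmod_iso (submod N) (submod K).

Definition finitely_generated M : Prop :=
  exists n (g : 'I_n -> M), forall x : M,
    exists a : 'I_n -> R, x = \sum_i a i *: g i.

Definition noetherian M : Prop :=
  forall N : nat -> submodClosed M,
    (forall i, {subset N i <= N i.+1}) ->
    exists m, forall i, (m <= i)%N -> N i =i N m.

Definition uniform M : Prop :=
  nonzero_mod M /\
  forall N L : submodClosed M, nonzero_submod N -> nonzero_submod L -> meets N L.

Definition udim_eq M (n : nat) : Prop :=
  exists U : 'I_n -> submodClosed M,
    [/\ forall i, uniform (submod (U i)), independent U
      & essential (sum_submod U)].

Definition udim_finite M : Prop := exists n, udim_eq M n.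

Section Quotient.
Variables (M : lmodType R) (N : submodClosed M).

Definition quot_equiv (x y : M) : bool := x - y \in N.

Fact quot_equivP : equiv_class_of quot_equiv.
Proof.
rewrite /quot_equiv; split=> [x|x y|y x z]; first by rewrite subrr rpred0.
  by rewrite -opprB submodN.
by move=> xy yz; rewrite -(subrKA y) rpredD.
Qed.
Canonical quot_equiv_equiv := EquivRelPack quot_equivP.
Canonical quot_equiv_encModRel := defaultEncModRel quot_equiv.

Definition quotm : Type := {eq_quot quot_equiv}.

HB.instance Definition _ : EqQuotient M quot_equiv quotm := EqQuotient.on quotm.
HB.instance Definition _ := Choice.on quotm.

Fact quotmE (x y : M) : (\pi_quotm x == \pi_quotm y) = (x - y \in N).
Proof. by rewrite piE. Qed.

Definition quotm_zero : quotm := lift_cst quotm 0.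
Definition quotm_opp : quotm -> quotm := lift_op1 quotm -%R.
Definition quotm_add : quotm -> quotm -> quotm := lift_op2 quotm +%R.
Definition quotm_scale (a : R) : quotm -> quotm := lift_op1 quotm ( *:%R a).

Fact repr_quotm (x : M) : repr (\pi_quotm x) - x \in N.
Proof. by rewrite -quotmE reprK. Qed.

Fact quotm_piN (x : M) : quotm_opp (\pi_quotm x) = \pi_quotm (- x).
Proof. by unlock quotm_opp; apply/eqP; rewrite quotmE -opprD submodN repr_quotm. Qed.

Fact quotm_piD (x y : M) :
  quotm_add (\pi_quotm x) (\pi_quotm y) = \pi_quotm (x + y).
Proof. by unlock quotm_add; apply/eqP; rewrite quotmE opprD addrACA rpredD ?repr_quotm. Qed.

Fact quotm_piZ a (x : M) : quotm_scale a (\pi_quotm x) = \pi_quotm (a *: x).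
Proof. by unlock quotm_scale; apply/eqP; rewrite quotmE -scalerBr rpredZ ?repr_quotm. Qed.

Fact quotm_addA : associative quotm_add.
Proof.
by elim/quotW=> x; elim/quotW=> y; elim/quotW=> z; rewrite !quotm_piD addrA.
Qed.
Fact quotm_addC : commutative quotm_add.
Proof. by elim/quotW=> x; elim/quotW=> y; rewrite !quotm_piD addrC. Qed.
Fact quotm_add0 : left_id quotm_zero quotm_add.
Proof. by elim/quotW=> x; unlock quotm_zero; rewrite quotm_piD add0r. Qed.
Fact quotm_addN : left_inverse quotm_zero quotm_opp quotm_add.
Proof. by elim/quotW=> x; unlock quotm_zero; rewrite quotm_piN quotm_piD addNr. Qed.
HB.instance Definition _ :=
  GRing.isZmodule.Build quotm quotm_addA quotm_addC quotm_add0 quotm_addN.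

Fact quotm_scaleA a b (x : quotm) :
  quotm_scale a (quotm_scale b x) = quotm_scale (a * b) x.
Proof. by elim/quotW: x => x; rewrite !quotm_piZ scalerA. Qed.
Fact quotm_scale1 : left_id 1 quotm_scale.
Proof. by elim/quotW=> x; rewrite quotm_piZ scale1r. Qed.
Fact quotm_scaleDr : right_distributive quotm_scale +%R.
Proof.
move=> a; elim/quotW=> x; elim/quotW=> y.
by rewrite [_ + _]quotm_piD !quotm_piZ scalerDr [RHS]quotm_piD.
Qed.
Fact quotm_scaleDl (x : quotm) : {morph quotm_scale^~ x : a b / a + b}.
Proof.
by move=> a b; elim/quotW: x => x; rewrite !quotm_piZ scalerDl [RHS]quotm_piD.
Qed.
HB.instance Definition _ :=
  GRing.Zmodule_isLmodule.Build R quotm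
    quotm_scaleA quotm_scale1 quotm_scaleDr quotm_scaleDl.

Definition quotm_proj (x : M) : quotm := \pi_quotm x.

Fact quotm_proj_linear : linear quotm_proj.
Proof. by move=> a x y; rewrite /quotm_proj -quotm_piD -quotm_piZ. Qed.
HB.instance Definition _ :=
  GRing.isLinear.Build R M quotm _ quotm_proj quotm_proj_linear.

Lemma quotm_proj_eq0 x : (quotm_proj x == 0) = (x \in N).
Proof. by rewrite -(raddf0 quotm_proj) quotmE subr0. Qed.

End Quotient.

Section DirectSum.
Variables (n : nat) (V : 'I_n -> lmodType R).

Definition dsum : Type := {dffun forall i : 'I_n, V i}.

HB.instance Definition _ := Choice.on dsum.

Definition dsum_zero : dsum := [ffun i => 0 : V i].
Definition dsum_opp (x : dsum) : dsum := [ffun i => - x i : V i].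
Definition dsum_add (x y : dsum) : dsum := [ffun i => x i + y i : V i].
Definition dsum_scale (a : R) (x : dsum) : dsum := [ffun i => a *: x i : V i].

Fact dsum_addA : associative dsum_add.
Proof. by move=> x y z; apply/ffunP => i; rewrite !ffunE addrA. Qed.
Fact dsum_addC : commutative dsum_add.
Proof. by move=> x y; apply/ffunP => i; rewrite !ffunE addrC. Qed.
Fact dsum_add0 : left_id dsum_zero dsum_add.
Proof. by move=> x; apply/ffunP => i; rewrite !ffunE add0r. Qed.
Fact dsum_addN : left_inverse dsum_zero dsum_opp dsum_add.
Proof. by move=> x; apply/ffunP => i; rewrite !ffunE addNr. Qed.
HB.instance Definition _ :=
  GRing.isZmodule.Build dsum dsum_addA dsum_addC dsum_add0 dsum_addN.

Fact dsum_scaleA a b (x : dsum) :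
  dsum_scale a (dsum_scale b x) = dsum_scale (a * b) x.
Proof. by apply/ffunP => i; rewrite !ffunE scalerA. Qed.
Fact dsum_scale1 : left_id 1 dsum_scale.
Proof. by move=> x; apply/ffunP => i; rewrite !ffunE scale1r. Qed.
Fact dsum_scaleDr : right_distributive dsum_scale +%R.
Proof. by move=> a x y; apply/ffunP => i; rewrite !ffunE scalerDr. Qed.
Fact dsum_scaleDl (x : dsum) : {morph dsum_scale^~ x : a b / a + b}.
Proof. by move=> a b; apply/ffunP => i; rewrite !ffunE scalerDl. Qed.
HB.instance Definition _ :=
  GRing.Zmodule_isLmodule.Build R dsum
    dsum_scaleA dsum_scale1 dsum_scaleDr dsum_scaleDl.

End DirectSum.

(* Left ideals of [R] are the submodules of the regular module [R^o]. *)

Definition two_sided (A : submodClosed R^o) : Prop :=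
  forall x r : R, x \in A -> x * r \in A.

Definition in_ideal_prod (A B : submodClosed R^o) (x : R) : Prop :=
  exists n (a b : 'I_n -> R),
    [/\ forall i, a i \in A, forall i, b i \in B & x = \sum_i a i * b i].

Definition quasi_prime (P : submodClosed R^o) : Prop :=
  (exists x : R, x \notin P) /\
  forall A B : submodClosed R^o, two_sided A -> two_sided B ->
    (forall x : R, in_ideal_prod A B x -> x \in P) ->
    (forall x : R, x \in P -> x \in A /\ x \in B) ->
    {subset A <= P} \/ {subset B <= P}.

End Modules.

(* [Ord f] denotes the least ordinal above all the [f a].  Classically [ole] is
   a total preorder whose quotient is the class of (small) ordinals; equality
   of ordinals is [ole] in both directions. *)
Inductive ord : Type := Ord (A : Type) (f : A -> ord).

Fixpoint ole (a b : ord) {struct a} : Prop :=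
  match a, b with Ord A f, Ord B g => forall i : A, exists j : B, ole (f i) (g j) end.

Definition olt (a b : ord) : Prop :=
  match b with Ord B g => exists j : B, ole a (g j) end.

Lemma ole_trans b a c : ole a b -> ole b c -> ole a c.
Proof.
elim: a b c => A f IH [B g] [C h] /= ab bc i.
have [j fg] := ab i; have [k gh] := bc j.
by exists k; apply: IH fg gh.
Qed.

Lemma olt_wf : well_founded olt.
Proof.
suff H a b : ole b a -> Acc olt b.
  by move=> a; apply: (H a); elim: a => A f IH /= i; exists i.
elim: a b => A f IH [B g] /= ba; constructor=> c [j cg].
by have [i gf] := ba j; apply: (IH i); apply: ole_trans cg gf.
Qed.

Section Krull.
Variable R : pzRingType.
Implicit Types M : lmodType R.

(* One step of the recursion: [below] stands for "K.dim < alpha".  The factor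
   M_i / M_{i+1} is the quotient of M_i by M_{i+1} seen inside M_i. *)
Definition kdim_step (below : lmodType R -> Prop) M : Prop :=
  ~ below M /\
  forall N : nat -> submodClosed M, (forall i, {subset N i.+1 <= N i}) ->
    exists m, forall i, (m <= i)%N ->
      below (quotm (inter_submod (N:=N i) (N i.+1))).

(* [kdim alpha M] is K.dim(M) = alpha; the value -1 of the zero module is not
   an [ord] and is treated apart. *)
Definition kdim : ord -> lmodType R -> Prop :=
  Fix olt_wf (fun=> lmodType R -> Prop) (fun alpha rec =>
    kdim_step (fun M => ~ nonzero_mod M \/
                        exists beta (h : olt beta alpha), rec beta h M)).

Definition kdim_lt (alpha : ord) M : Prop :=
  ~ nonzero_mod M \/ exists2 beta, olt beta alpha & kdim beta M.

Lemma kdimE alpha M : kdim alpha M <-> kdim_step (kdim_lt alpha) M.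
Proof.
rewrite /kdim Fix_eq; last first.
  move=> a f g fg; congr kdim_step; apply/funext => V.
  by congr (_ \/ _); apply/propext; split=> -[b [h]] H; exists b, h;
    rewrite ?fg // -fg.
rewrite -/kdim; suff -> : (fun V => ~ nonzero_mod V \/
  exists beta (h : olt beta alpha), kdim beta V) = kdim_lt alpha by [].
apply/funext => V; congr (_ \/ _); apply/propext.
by split=> [[b [h H]]|[b h H]]; exists b.
Qed.

Definition alpha_critical (alpha : ord) M : Prop :=
  kdim alpha M /\
  forall N : submodClosed M, nonzero_submod N -> kdim_lt alpha (quotm N).

Definition critical M : Prop := exists alpha, alpha_critical alpha M.

End Krull.

(* Main.v *)
From HB Require Import structures.
Require Import Defs.
From mathcomp Require Import all_boot all_order all_algebra.
From mathcomp Require Import boolp.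

Set Implicit Arguments.
Unset Strict Implicit.
Unset Printing Implicit Defensive.

Import GRing.Theory.
Local Open Scope ring_scope.

(** Everything rests on one remark: if M is virtually semisimple of finite
    uniform dimension n and N is essential in M, then N is isomorphic to M
    ([vss_essential]). Indeed N is isomorphic to some K with M = K + L direct.
    Since N meets each of n uniform summands, K contains n independent nonzero
    cyclic submodules; a nonzero element of L would give an n+1st, while no
    independent family of nonzero submodules has more than n members
    ([cyclic_indep_card], a Steinitz exchange). So L = 0 and N ~ K = M.

    Take uniform independent U_1, ..., U_n with essential sum and nonzero
    x_i in U_i. The sum of the R x_i is again essential ([essential_meets]), so
    M is isomorphic to it, hence finitely generated; and a finitely generated
    virtually semisimple module is Noetherian, because its submodules are, up to
    isomorphism, summands ([vss_fg_noetherian]). Conversely a Noetherian module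
    has finite uniform dimension ([noetherian_udim]).

    Once M is known to be Noetherian, the x_i can be chosen again, more
    carefully, so that R / ann(x_i) ~ R x_i is critical and ann(x_i) is quasi
    prime ([quasi_prime_critical_cyclic]); the isomorphism of M with the direct
    sum of the R x_i then is the decomposition sought. The choice goes in two
    steps.
    - A nonzero Noetherian module has a Krull dimension ([noetherian_kdim]).
      Take alpha least among the Krull dimensions of nonzero submodules, and W
      a submodule of dimension alpha. If every nonzero N inside W had a nonzero
      N' with N/N' not of dimension below alpha, iterating would contradict
      K.dim W = alpha; so some N is such that all its proper factors have
      dimension below alpha. By the minimality of alpha all nonzero
      submodules of N are then alpha-critical ([noetherian_critical]).
    - Among the nonzero x in N choose one whose annihilator P is maximal. If
      AB is inside P, P is inside A and B, and b in B is not in P, then b x is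
      nonzero and A annihilates it; as P is inside A, the maximality of P
      gives A inside P. *)
Section Modules.
Variable R : pzRingType.
Implicit Types U V W M : lmodType R.

(** * Submodules, quotients and linear maps *)

Lemma submod_exists M (P : M -> Prop) :
    P 0 -> (forall a x y, P x -> P y -> P (a *: x + y)) ->
  exists N : submodClosed M, forall x, x \in N <-> P x.
Proof.
move=> P0 PL; pose Q : {pred M} := fun x => `[< P x >].
have clQ : submod_closed Q.
  split=> [|a x y]; rewrite !unfold_in /Q; first exact/asboolP.
  by move=> /asboolP Px /asboolP Py; apply/asboolP; apply: PL.
pose mix := GRing.isSubmodClosed.Build R M Q clQ.
pose N : submodClosed M := HB.pack Q mix.
by exists N => x; split=> [/asboolP|Px] //; apply/asboolP.
Qed.

Lemma linear_exists U V (f : U -> V) :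
  linear f -> exists g : {linear U -> V}, g =1 f.
Proof.
move=> lf; pose mix := GRing.isLinear.Build R U V _ f lf.
by pose g : {linear U -> V} := HB.pack f mix; exists g.
Qed.

Lemma image_exists U V (f : {linear U -> V}) (N : submodClosed U) :
  exists N' : submodClosed V,
    forall y, y \in N' <-> exists2 x, x \in N & y = f x.
Proof.
apply: submod_exists => [|a _ _ [x xN ->] [y yN ->]].
  by exists 0; rewrite ?rpred0 ?raddf0.
by exists (a *: x + y); rewrite ?linearP // rpredD // rpredZ.
Qed.

Lemma preimage_exists U V (f : {linear U -> V}) (N : submodClosed V) :
  exists N' : submodClosed U, forall x, x \in N' = (f x \in N).
Proof.
have [|a x y fx fy|N' N'P] := @submod_exists U (fun x => f x \in N).
- by rewrite raddf0 rpred0.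
- by rewrite linearP rpredD // rpredZ.
by exists N' => x; apply/idP/idP => /N'P.
Qed.

Lemma zero_submod_exists M :
  exists Z : submodClosed M, forall y, y \in Z <-> y = 0.
Proof. by apply: submod_exists => // a _ _ -> ->; rewrite scaler0 addr0. Qed.

Lemma ann_exists M (x : M) :
  exists P : submodClosed R^o, forall a : R, a \in P <-> a *: x = 0.
Proof.
apply: (@submod_exists R^o (fun a : R => a *: x = 0)) => [|a b c bx cx].
  by rewrite scale0r.
by rewrite scalerDl -(scalerA a b) bx cx scaler0 addr0.
Qed.

Lemma lincomb_exists M n (x : 'I_n -> M) (D : pred 'I_n) :
  exists N : submodClosed M,
    forall y, y \in N <-> exists a : 'I_n -> R, y = \sum_(i | D i) a i *: x i.
Proof.
apply: submod_exists => [|c _ _ [a ->] [b ->]].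
  by exists (fun=> 0); rewrite big1 // => i _; rewrite scale0r.
exists (fun i => c * a i + b i); rewrite scaler_sumr -big_split /=.
by apply: eq_bigr => i _; rewrite scalerDl scalerA.
Qed.

Lemma cycle_exists M (x : M) :
  exists N : submodClosed M, forall y, y \in N <-> exists a : R, y = a *: x.
Proof.
apply: submod_exists => [|c _ _ [a ->] [b ->]].
  by exists 0; rewrite scale0r.
by exists (c * a + b); rewrite scalerDl scalerA.
Qed.

(** The Krull dimension arguments move freely between submodules, submodules of
    submodules and isomorphic copies of these; stating them for embedded modules
    covers all three at once. *)
Definition embeds U V := exists f : {linear U -> V}, injective f.

Lemma embeds_trans V U W : embeds U V -> embeds V W -> embeds U W.
Proof. by case=> f injf [g injg]; exists (g \o f) => x y /= /injg/injf. Qed.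

Lemma lmod_iso_embeds U V : lmod_iso U V -> embeds U V.
Proof. by case=> f /bij_inj injf; exists f. Qed.

Lemma linear_inj0 U V (f : {linear U -> V}) :
  (forall x, f x = 0 -> x = 0) -> injective f.
Proof.
move=> f0 x y /eqP; rewrite -subr_eq0 -raddfB => /eqP/f0/eqP.
by rewrite subr_eq0 => /eqP.
Qed.

Lemma val_lincomb M (N : submodClosed M) n (a : 'I_n -> R) (y : 'I_n -> submod N) :
  val (\sum_i a i *: y i) = \sum_i a i *: val (y i).
Proof. by rewrite linear_sum. Qed.

Lemma embeds_submod M (N : submodClosed M) : embeds (submod N) M.
Proof. by exists val; apply: val_inj. Qed.

Lemma submod_lift M (N : submodClosed M) x :
  x \in N -> exists y : submod N, val y = x.
Proof. by move=> xN; exists (Sub x xN : submod N); rewrite SubK. Qed.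

Lemma quotm_projK M (N : submodClosed M) (q : quotm N) :
  exists x, q = quotm_proj N x.
Proof. by exists (repr q); rewrite /quotm_proj reprK. Qed.

Lemma quotm_factor U V (g : {linear U -> V}) (K : submodClosed U) :
    (forall x, x \in K -> g x = 0) ->
  exists h : {linear quotm K -> V}, forall x, h (quotm_proj K x) = g x.
Proof.
move=> Kg; pose h0 (q : quotm K) := g (repr q).
have h0E x : h0 (quotm_proj K x) = g x.
  apply/eqP; rewrite -subr_eq0 -raddfB; apply/eqP/Kg.
  exact: repr_quotm.
have [|h hE] := @linear_exists (quotm K) V h0; last by exists h => x; rewrite hE.
move=> a p q; have [x ->] := quotm_projK p; have [y ->] := quotm_projK q.
by rewrite -linearP !h0E linearP.
Qed.

Lemma quotm_embeds U V (g : {linear U -> V}) (K : submodClosed U) :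
  (forall x, (x \in K) <-> g x = 0) -> embeds (quotm K) V.
Proof.
move=> Kg; have [|h hE] := @quotm_factor U V g K; first by move=> x /Kg.
exists h; apply: linear_inj0 => q; have [x ->] := quotm_projK q.
by rewrite hE => /Kg xK; apply/eqP; rewrite quotm_proj_eq0.
Qed.

(** Every comparison of chain factors below is an instance of this lemma,
    with g a restricted embedding or the inclusion of a submodule. *)
Lemma quotm_comp_embeds U V (g : {linear U -> V}) (K : submodClosed U)
    (N : submodClosed V) :
  (forall x, x \in K = (g x \in N)) -> embeds (quotm K) (quotm N).
Proof.
move=> KN; apply: (@quotm_embeds _ _ (quotm_proj N \o g)) => x.
by rewrite KN -quotm_proj_eq0; split=> /eqP.
Qed.

Lemma in_inter_submod M (N L : submodClosed M) (x : submod N) :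
  (x \in inter_submod L) = (val x \in L).
Proof. by rewrite [LHS]unfold_in. Qed.

Lemma lmod_iso_sym U V : lmod_iso U V -> lmod_iso V U.
Proof.
case=> f [g fK gK].
have [|h hE] := @linear_exists V U g.
  by move=> a x y; apply: (can_inj fK); rewrite gK linearP !gK.
by exists h, f => x; rewrite hE.
Qed.

Lemma lmod_iso_trans V U W : lmod_iso U V -> lmod_iso V W -> lmod_iso U W.
Proof.
case=> f [f' fK f'K] [g [g' gK g'K]]; exists (g \o f), (f' \o g') => x /=.
  by rewrite gK fK.
by rewrite f'K g'K.
Qed.

Lemma linear_to_submod U M (f : {linear U -> M}) (N : submodClosed M) :
    (forall x, f x \in N) ->
  exists g : {linear U -> submod N}, forall x, val (g x) = f x.
Proof.
move=> fN.
have [|h hE] := @linear_exists U (submod N) (fun x => Sub (f x) (fN x)).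
  by move=> a x y; apply: val_inj; rewrite [RHS]linearP !SubK linearP.
by exists h => x; rewrite hE SubK.
Qed.

Lemma lmod_iso_image U M (f : {linear U -> M}) (N : submodClosed M) :
    injective f -> (forall y, y \in N <-> exists x, y = f x) ->
  lmod_iso U (submod N).
Proof.
move=> injf NE; have fN x : f x \in N by apply/NE; exists x.
have [h hE] := linear_to_submod fN.
have /choice[g gE] (y : submod N) : exists x, val y = f x by apply/NE/(valP y).
exists h, g => [x|y]; last by apply: val_inj; rewrite hE -gE.
by apply: injf; rewrite -gE hE.
Qed.

(** * Finite generation and the ascending chain condition *)

Lemma fg_surj U V (f : {linear U -> V}) :
  (forall y, exists x, y = f x) -> finitely_generated U -> finitely_generated V.
Proof.
move=> fS [n [g gE]]; exists n, (f \o g) => y; have [x ->] := fS y.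
have [a ->] := gE x; exists a; rewrite linear_sum; apply: eq_bigr => i _.
by rewrite linearZ.
Qed.

Lemma fg_iso U V : lmod_iso U V -> finitely_generated U -> finitely_generated V.
Proof. by case=> f [g _ gK]; apply: (@fg_surj _ _ f) => y; exists (g y). Qed.

(** The components in K of the generators of M generate K, as the part of a
    combination lying in the complement must vanish. *)
Lemma fg_summand M (K : submodClosed M) :
  direct_summand K -> finitely_generated M -> finitely_generated (submod K).
Proof.
case=> L [KL KL0] [n [g gE]].
have /choice[k kP] i : exists k : submod K, g i - val k \in L.
  have [k [l [kK lL ->]]] := KL (g i); have [k' <-] := submod_lift kK.
  by exists k'; rewrite addrC addKr.
exists n, k => y; have [a yE] := gE (val y); exists a; apply: val_inj.
apply/eqP; rewrite -subr_eq0; apply/eqP/KL0.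
  by rewrite -raddfB; apply: valP.
rewrite val_lincomb yE -sumrB; apply: rpred_sum => i _.
by rewrite -scalerBr rpredZ.
Qed.

Lemma chain_subset M (N : nat -> submodClosed M) :
    (forall i, {subset N i <= N i.+1}) ->
  forall i j, (i <= j)%N -> {subset N i <= N j}.
Proof.
move=> Nup i j /subnK <-; elim: (j - i)%N => [|k IH] // x /IH.
exact: Nup.
Qed.

(** The union of an ascending chain is a submodule, and its finitely many
    generators already lie in some member of the chain. *)
Lemma all_fg_noetherian M :
  (forall N : submodClosed M, finitely_generated (submod N)) -> noetherian M.
Proof.
move=> fgM N Nup; have Nle := chain_subset Nup.
have [||U UE] := @submod_exists M (fun x => exists i, x \in N i).
- by exists 0%N; rewrite rpred0.
- move=> a x y [i xi] [j yj]; exists (maxn i j).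
  by rewrite rpredD ?rpredZ // ?(Nle _ _ (leq_maxl _ _) _ xi)
    ?(Nle _ _ (leq_maxr _ _) _ yj).
have [n [g gE]] := fgM U.
have /choice[m mP] j : exists i, val (g j) \in N i by apply/UE/(valP (g j)).
exists (\max_j m j) => i le_i x; apply/idP/idP => [xi|]; last exact: Nle.
have /submod_lift[y yx] : x \in U by apply/UE; exists i.
have [a yE] := gE y; rewrite -yx yE val_lincomb; apply: rpred_sum => j _.
rewrite rpredZ //; apply: Nle (mP j).
exact: (leq_bigmax (F := m)).
Qed.

Lemma noetherian_embeds W M : embeds W M -> noetherian M -> noetherian W.
Proof.
case=> f injf noeM N Nup.
have /choice[N' N'E] i := image_exists f (N i).
have [|m mP] := noeM N'.
  by move=> i _ /N'E[x xN ->]; apply/N'E; exists x => //; apply: Nup.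
have fN i x : (f x \in N' i) = (x \in N i).
  by apply/idP/idP => [/N'E[y yN /injf ->]|xN] //; apply/N'E; exists x.
by exists m => i /mP mi x; rewrite -!fN mi.
Qed.

(** Otherwise dependent choice would build a strictly ascending chain. *)
Lemma noetherian_max M (F : submodClosed M -> Prop) N0 :
    noetherian M -> F N0 ->
  exists2 N, F N & forall N', F N' -> {subset N <= N'} -> {subset N' <= N}.
Proof.
move=> noeM FN0; apply: contrapT => nomax.
have step (N : {N | F N}) : exists N' : {N | F N},
    {subset sval N <= sval N'} /\ ~ {subset sval N' <= sval N}.
  case: N => N FN /=; apply: contrapT => none; apply: nomax; exists N => // N' FN' sub.
  by apply: contrapT => nsub; apply: none; exists (exist _ N' FN').
have [s sP] := choice step.
pose c i := sval (iter i s (exist _ N0 FN0)).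
have [|m mP] := noeM c; first by move=> i; case: (sP (iter i s (exist _ N0 FN0))).
have [_] := sP (iter m s (exist _ N0 FN0)); apply => x.
have := mP m.+1 (leqnSn m) x; rewrite /c /= => ->; exact.
Qed.

(** * Uniform dimension *)

(** Independence of the cyclic submodules R x_i: weaker than linear
    independence of the x_i, which may have nonzero annihilators. *)
Definition cyclic_indep M n (x : 'I_n -> M) : Prop :=
  forall a : 'I_n -> R, \sum_i a i *: x i = 0 -> forall i, a i *: x i = 0.

Lemma essentialP M (X : submodClosed M) :
  essential X <->
  forall v, v != 0 -> exists2 r : R, r *: v \in X & r *: v != 0.
Proof.
split=> [essX v v0|essX L [v vL v0]].
  have [C CE] := cycle_exists v; have [|y [yX /CE[r yr] y0]] := essX C.
    by exists v => //; apply/CE; exists 1; rewrite scale1r.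
  by exists r; rewrite -yr.
by have [r rX r0] := essX v v0; exists (r *: v); split=> //; apply: rpredZ.
Qed.

Lemma uniformP M (U : submodClosed M) :
  uniform (submod U) <->
  nonzero_submod U /\
  forall x y, x \in U -> y \in U -> x != 0 -> y != 0 ->
    exists r s : R, r *: x = s *: y /\ r *: x != 0.
Proof.
split=> [[[u u0] uni]|[[u uU u0] uni]]; split.
- by exists (val u); [exact: valP | rewrite -(inj_eq val_inj) in u0].
- move=> _ _ /submod_lift[x <-] /submod_lift[y <-] x0 y0.
  have [X XE] := cycle_exists x; have [Y YE] := cycle_exists y.
  have [||w [/XE[r wr] /YE[s ws] w0]] := uni X Y.
  + by exists x; [apply/XE; exists 1; rewrite scale1r | rewrite -(inj_eq val_inj)].
  + by exists y; [apply/YE; exists 1; rewrite scale1r | rewrite -(inj_eq val_inj)].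
  exists r, s; rewrite -[r *: val x]/(val (r *: x)) -wr; split.
    by rewrite ws.
  by rewrite -(inj_eq val_inj) in w0.
- have [x xu] := submod_lift uU.
  by exists x; rewrite -(inj_eq val_inj) xu.
- move=> N L [x xN x0] [y yL y0].
  have [r [s [rs r0]]] := uni (val x) (val y) (valP x) (valP y) x0 y0.
  exists (r *: x); split=> //; first by rewrite rpredZ.
  have -> : r *: x = s *: y by apply: val_inj.
  by rewrite rpredZ.
Qed.

(** Essentiality is tested on the uniform pieces. A nonzero v has a nonzero
    multiple in the sum of the U i, and each component of it outside X can be
    moved into X by a scalar that does not annihilate it, since X meets U i and
    U i is uniform; the sum then stays nonzero by independence, and the components
    already in X stay there. Hence the induction on the number of components
    outside X. *)
Lemma essential_meets M n (U : 'I_n -> submodClosed M) (X : submodClosed M) :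
    (forall i, uniform (submod (U i))) -> independent U ->
    essential (sum_submod U) -> (forall i, meets X (U i)) ->
  essential X.
Proof.
move=> uniU indU /essentialP essU XU; apply/essentialP => v v0.
suff claim k (u : 'I_n -> M) : (forall i, u i \in U i) ->
    (#|[set i | u i \notin X]| <= k)%N -> \sum_i u i != 0 ->
    exists2 r : R, r *: (\sum_i u i) \in X & r *: (\sum_i u i) != 0.
  have [s /asboolP[u uU su] s0] := essU v v0.
  have [|r rX r0] := claim _ u uU (leqnn _); first by rewrite -su.
  by exists (r * s); rewrite -scalerA su.
elim: k u => [|k IH] u uU lek sum0.
  exists 1; rewrite scale1r //; apply: rpred_sum => i _; apply: contraLR lek => uiX.
  by rewrite -ltnNge card_gt0; apply/set0Pn; exists i; rewrite inE.
have [allX|] := boolP [forall i, u i \in X].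
  by exists 1; rewrite scale1r //; apply: rpred_sum => i _; apply: (forallP allX).
rewrite negb_forall => /existsP[j ujX].
have uj0 : u j != 0 by apply: contraNneq ujX => ->; rewrite rpred0.
have [y [yX yU y0]] := XU j.
have [r [s [rs r0]]] : exists r s : R, r *: u j = s *: y /\ r *: u j != 0.
  by have /uniformP[_ uni] := uniU j; apply: uni.
have [|||t tX t0] := IH (fun i => r *: u i).
- by move=> i; rewrite rpredZ.
- rewrite -ltnS (leq_trans _ lek) //; apply: proper_card; apply/properP; split.
    by apply/subsetP => i; rewrite !inE; apply: contraNN; apply: rpredZ.
  by exists j; rewrite !inE ?ujX // rs rpredZ.
- apply: contraNneq r0 => sum_r0; apply/eqP.
  by apply: (indU (fun i => r *: u i)) => // i; rewrite rpredZ.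
by exists (t * r); rewrite -scalerA scaler_sumr.
Qed.

(** Steinitz exchange. The x i are replaced one at a time by elements of the
    U l. When z i0 is to be replaced, the span X of the other z j is not
    essential, since it does not meet R z_i0; hence X misses some U l entirely,
    and any nonzero element of U l may stand for z i0. In the end all m
    elements lie in the U l, and two in the same uniform U l cannot be
    independent: pigeonhole. *)
Lemma cyclic_indep_card M n (U : 'I_n -> submodClosed M) m (x : 'I_m -> M) :
    (forall i, uniform (submod (U i))) -> independent U ->
    essential (sum_submod U) -> cyclic_indep x -> (forall i, x i != 0) ->
  (m <= n)%N.
Proof.
move=> uniU indU essU indx x0; pose good (k : nat) (z : 'I_m -> M) :=
  [/\ cyclic_indep z, forall i, z i != 0
    & forall i : 'I_m, (i < k)%N -> exists l, z i \in U l].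
suff [z [indz z0 zU]] : exists z, good m z.
  have /choice[c cP] i := zU i (ltn_ord i).
  rewrite -[m]card_ord -[n]card_ord; apply: (leq_card c) => i j cij.
  apply/eqP; apply: contraPT isT => ij _.
  have [_ uni] := (uniformP (U (c i))).1 (uniU (c i)).
  have [||r [s [rs /negP[]]]] := uni (z i) (z j) _ _ (z0 i) (z0 j).
  - exact: cP.
  - by rewrite cij cP.
  (* a common multiple r z_i = s z_j gives a dependence relation *)
  have := indz (fun h => if h == i then r else if h == j then - s else 0).
  move=> /(_ _ i); rewrite eqxx => -> //.
  have ji : j != i by rewrite eq_sym.
  rewrite (bigD1 i) //= eqxx (bigD1 j) //= eqxx (negPf ji) big1 ?addr0 ?scaleNr ?rs ?subrr //.
  by move=> h /andP[/negPf-> /negPf->]; rewrite scale0r.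
suff claim k : (k <= m)%N -> exists z, good k z by apply: claim.
elim: k => [|k IH] lekm; first by exists x; split.
have [z [indz z0 zU]] := IH (ltnW lekm); pose i0 := Ordinal lekm.
have [X XE] := lincomb_exists z (fun j => j != i0).
have [l noX] : exists l, ~ meets X (U l).
  apply: contrapT => allX; have /essentialP/(_ _ (z0 i0)) : essential X.
    by apply: essential_meets essU _ => // l; apply: contrapT => nl; apply: allX; exists l.
  case=> r /XE[a aE] /negP[].
  have := indz (fun j => if j == i0 then - r else a j).
  move=> /(_ _ i0); rewrite eqxx scaleNr => H.
  apply/eqP/oppr_inj; rewrite oppr0; apply: H.
  rewrite (bigD1 i0) //= eqxx scaleNr aE addrC; apply/eqP; rewrite subr_eq0.
  by apply/eqP/eq_bigr => j /negPf->.
have [[u uU u0] _] := (uniformP (U l)).1 (uniU l).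
exists (fun j => if j == i0 then u else z j); split=> [a|j|j].
- rewrite (bigD1 i0) //= eqxx => sum0.
  have sumE : \sum_(j | j != i0) a j *: (if j == i0 then u else z j)
      = \sum_(j | j != i0) a j *: z j by apply: eq_bigr => j /negPf->.
  have au0 : a i0 *: u = 0.
    apply/eqP/negPn/negP => au0; apply: noX; exists (a i0 *: u); split=> //.
      apply/XE; exists (fun j => - a j); apply/eqP.
      under eq_bigr do rewrite scaleNr.
      by rewrite sumrN -subr_eq0 opprK -sumE sum0.
    by rewrite rpredZ.
  move=> j; have [->//|ji0] := eqVneq j i0.
  have := indz (fun j => if j == i0 then 0 else a j).
  move=> /(_ _ j); rewrite (negPf ji0); apply.
  rewrite (bigD1 i0) //= eqxx scale0r add0r.
  move: sum0; rewrite sumE au0 add0r => sum0; rewrite -[RHS]sum0.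
  by apply: eq_bigr => h /negPf->.
- by case: (j =P i0).
- rewrite ltnS leq_eqVlt => /orP[/eqP jk|jk].
    have -> : j = i0 by apply: val_inj.
    by rewrite eqxx; exists l.
  by case: (j =P i0) => _; [exists l | apply: zU].
Qed.

(** * Noetherian modules have finite uniform dimension *)

(** Take K maximal among the submodules disjoint from some nonzero submodule L'
    of L. Then L' is uniform: if R y and R z inside L' were disjoint, then
    K + R y would be disjoint from R z, against the maximality of K. *)
Lemma noetherian_uniform M (L : submodClosed M) :
    noetherian M -> nonzero_submod L ->
  exists2 U : submodClosed M, {subset U <= L} & uniform (submod U).
Proof.
move=> noeM [x xL x0].
pose disj (K L' : submodClosed M) := forall y, y \in K -> y \in L' -> y = 0.
pose F (K : submodClosed M) := exists L' : submodClosed M,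
  [/\ {subset L' <= L}, nonzero_submod L' & disj K L'].
have [Z ZE] := zero_submod_exists M.
have [|K [L' [L'L L'0 KL']] Kmax] := @noetherian_max M F Z noeM.
  by exists L; split=> //; [exists x | move=> y /ZE].
exists L' => //; apply/uniformP; split=> // y z yL zL y0 z0.
apply: contrapT => nomeet.
have [||K' K'E] := @submod_exists M
  (fun v => exists (k : M) (a : R), k \in K /\ v = k + a *: y).
- by exists 0, 0; rewrite rpred0 scale0r addr0.
- move=> c _ _ [k [a [kK ->]]] [k' [a' [k'K ->]]].
  exists (c *: k + k'), (c * a + a'); rewrite rpredD ?rpredZ //; split=> //.
  by rewrite scalerDr scalerDl scalerA addrACA.
have yK' : y \in K' by apply/K'E; exists 0, 1; rewrite rpred0 scale1r add0r.
have /Kmax/(_ _ y yK') yK : F K'.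
  have [Cz CzE] := cycle_exists z; exists Cz; split.
  - by move=> _ /CzE[a ->]; rewrite rpredZ ?L'L.
  - by exists z => //; apply/CzE; exists 1; rewrite scale1r.
  move=> _ /K'E[k [a [kK ->]]] /CzE[b kb].
  have k0 : k = 0.
    apply: KL' => //; have -> : k = b *: z - a *: y by rewrite -kb addrK.
    by rewrite rpredD ?rpredN ?submodN ?rpredZ.
  rewrite k0 add0r in kb *; apply: contrapT => /eqP ay0; apply: nomeet.
  by exists a, b.
have: y = 0 by apply: KL' => //; apply: yK => k kK; apply/K'E; exists k, 0; rewrite scale0r addr0.
by move/eqP; apply/negP.
Qed.

(** A maximal finite direct sum of uniform submodules is essential: a nonzero
    submodule disjoint from it contains a uniform one, which could be added. *)
Lemma noetherian_udim M : noetherian M -> udim_finite M.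
Proof.
move=> noeM.
pose F (S : submodClosed M) := exists n (U : 'I_n -> submodClosed M),
  [/\ forall i, uniform (submod (U i)), independent U
    & forall x, x \in S <-> x \in sum_submod U].
have [Z ZE] := zero_submod_exists M.
have [|S [n [U [uniU indU SE]]] Smax] := @noetherian_max M F Z noeM.
  exists 0%N, (fun=> Z); split=> [[]|x _ _ []|x] //; split.
    by move=> /ZE ->; rewrite rpred0.
  by move=> /asboolP[y _ ->]; rewrite big_ord0 rpred0.
exists n, U; split=> // L L0; apply: contrapT => nomeet.
have [V VL uniV] := noetherian_uniform noeM L0.
pose U' (i : 'I_n.+1) := if unlift ord0 i is Some j then U j else V.
have U'0 : U' ord0 = V by rewrite /U' unlift_none.
have U'S j : U' (lift ord0 j) = U j by rewrite /U' liftK.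
have [S' S'E] : exists S' : submodClosed M, forall x, x \in S' <-> x \in sum_submod U'.
  by pose S' : submodClosed M := sum_submod U'; exists S'.
have SS' : {subset S <= S'}.
  move=> x /SE/asboolP[u uU ->]; apply/S'E/asboolP.
  exists (fun i => if unlift ord0 i is Some j then u j else 0) => [i|].
    by rewrite /U'; case: unlift => [j|] //; rewrite rpred0.
  rewrite big_ord_recl unlift_none add0r; apply: eq_bigr => j _.
  by rewrite liftK.
have VS' : {subset V <= S'}.
  move=> v vV; apply/S'E/asboolP; exists (fun i => if i == ord0 then v else 0) => [i|].
    by case: eqP => [->|_]; rewrite ?U'0 ?rpred0.
  by rewrite big_ord_recl eqxx big1 ?addr0.
have /Smax/(_ SS') S'S : F S'.
  exists n.+1, U'; split=> // [i|x xU].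
    by rewrite /U'; case: unlift => [j|].
  rewrite big_ord_recl => sum0.
  have x0V : x ord0 \in V by rewrite -U'0.
  have xS j : x (lift ord0 j) \in U j by rewrite -U'S.
  have x00 : x ord0 = 0.
    apply: contrapT => /eqP x00; apply: nomeet; exists (x ord0); split=> //.
      apply/asboolP; exists (fun j => - x (lift ord0 j)) => [j|].
        by rewrite submodN.
      by apply/eqP; rewrite -subr_eq0 sumrN opprK sum0.
    exact: VL.
  move=> i; case: (unliftP ord0 i) => [j ->|->] //.
  by apply: (indU (fun j => x (lift ord0 j))) => //; rewrite x00 add0r in sum0.
have [[v vV v0] _] := (uniformP V).1 uniV.
by apply: nomeet; exists v; split=> //; [apply/SE/S'S/VS' | apply: VL].
Qed.

(** * Essential submodules of virtually semisimple modules *)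

(** With N ~ K and M = K + L direct, L vanishes: the images in K of nonzero
    elements of the N :&: U i, together with a nonzero element of L, would be
    too many independent elements. *)
Lemma vss_essential M (N : submodClosed M) :
    virtually_semisimple M -> udim_finite M -> essential N ->
  lmod_iso M (submod N).
Proof.
move=> vssM [n [U [uniU indU essU]]] essN.
have [K [L [KL KL0]] isoNK] := vssM N.
apply: (@lmod_iso_trans (submod K)); last exact: lmod_iso_sym.
have allK x : x \in K.
  have [k [l [kK lL ->]]] := KL x.
  suff /eqP-> : l == 0 by rewrite addr0.
  apply/negPn/negP => l0.
  have /choice[x0 x0P] i : exists y : M, [/\ y \in N, y \in U i & y != 0].
    have [[u uU u0] _] := (uniformP (U i)).1 (uniU i).
    by apply: essN; exists u.
  have /choice[y yE] i : exists y : submod N, val y = x0 i.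
    by apply: submod_lift; case: (x0P i).
  have [g [g' gK g'K]] := isoNK.
  pose z (i : 'I_n.+1) := if unlift ord0 i is Some j then val (g (y j)) else l.
  have zS j : z (lift ord0 j) = val (g (y j)) by rewrite /z liftK.
  have z0 : z ord0 = l by rewrite /z unlift_none.
  suff: (n.+1 <= n)%N by rewrite ltnn.
  (* a relation splits along K + L; its part in K pulls back to N, where the
     independence of the U i applies *)
  apply: (@cyclic_indep_card _ _ U _ z) => // [a|i].
    rewrite big_ord_recl z0; under eq_bigr do rewrite zS.
    rewrite -val_lincomb => sum0.
    have al0 : a ord0 *: l = 0.
      apply: KL0; last by rewrite rpredZ.
      rewrite -submodN; move/eqP: sum0; rewrite addrC addr_eq0 => /eqP<-.
      exact: valP.
    move=> i; case: (unliftP ord0 i) => [j ->|->]; last by rewrite z0.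
    rewrite al0 add0r in sum0.
    have: \sum_j a (lift ord0 j) *: g (y j) = 0 by apply: val_inj.
    have -> : \sum_j a (lift ord0 j) *: g (y j) = g (\sum_j a (lift ord0 j) *: y j).
      by rewrite linear_sum; apply: eq_bigr => h _; rewrite linearZ.
    rewrite -(raddf0 g) => /(can_inj gK) /(congr1 val); rewrite val_lincomb => sumy.
    have ay0 : a (lift ord0 j) *: x0 j = 0.
      apply: (indU (fun j => a (lift ord0 j) *: x0 j)) => [h|].
        by rewrite rpredZ //; case: (x0P h).
      by rewrite -[RHS]sumy; apply: eq_bigr => h _; rewrite yE.
    have : a (lift ord0 j) *: y j = 0 by apply: val_inj; rewrite -[RHS]ay0 -yE.
    move=> /(congr1 g); rewrite linearZ raddf0 => /(congr1 val) H.
    by rewrite zS; exact: H.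
  rewrite /z; case: unlift => [j|] //; have [_ _] := x0P j; apply: contraNneq => gy0.
  have /eqP : g (y j) = 0 by apply: val_inj.
  by rewrite -(raddf0 g) (can_eq gK) -yE => /eqP->.
by apply: (lmod_iso_image (f := idfun)) => // y; split=> // _; exists y.
Qed.

(** * Krull dimension *)

Lemma ole_refl a : ole a a.
Proof. by elim: a => A f IH /= i; exists i. Qed.

Lemma olt_ole_trans b a c : olt a b -> ole b c -> olt a c.
Proof.
case: b c => B g [C h] /= [j agj] gh; have [k gjhk] := gh j.
by exists k; apply: ole_trans gjhk.
Qed.

Lemma oltW a b : olt a b -> ole a b.
Proof.
elim: a b => A f IH [B g] /= [j fgj] i; exists j.
by apply: IH; case: (g j) fgj => C h /=; apply.
Qed.

Lemma ole_Ord A (f : A -> ord) i : ole (f i) (Ord f).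
Proof. by apply: oltW; exists i; apply: ole_refl. Qed.

Definition kdim_chain (alpha : ord) M : Prop :=
  forall N : nat -> submodClosed M, (forall i, {subset N i.+1 <= N i}) ->
    exists m, forall i, (m <= i)%N ->
      kdim_lt alpha (quotm (inter_submod (N:=N i) (N i.+1))).

Lemma kdimP alpha M : kdim alpha M <-> ~ kdim_lt alpha M /\ kdim_chain alpha M.
Proof. exact: kdimE. Qed.

Lemma kdim_lt_ole a b M : ole a b -> kdim_lt a M -> kdim_lt b M.
Proof.
move=> ab [M0|[c ca cM]]; first by left.
by right; exists c => //; apply: olt_ole_trans ab.
Qed.

(** The chain condition at beta alone bounds the Krull dimension by beta: either
    it is already smaller, or it equals beta by definition. *)
Lemma kdim_chain_lt alpha beta M :
  olt beta alpha -> kdim_chain beta M -> kdim_lt alpha M.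
Proof.
move=> ba cM; case: (EM (kdim_lt beta M)) => [|nlt].
  exact/kdim_lt_ole/oltW.
by right; exists beta => //; apply/kdimP.
Qed.

Lemma nonzero_embeds U V : embeds U V -> nonzero_mod U -> nonzero_mod V.
Proof.
case=> f injf [x x0]; exists (f x); apply: contraNneq x0 => fx0.
by apply/eqP/injf; rewrite fx0 raddf0.
Qed.

Lemma quotm_chain_embeds M (N N' : submodClosed M) :
  embeds (quotm (inter_submod (N:=N) N')) (quotm N').
Proof.
by apply: (quotm_comp_embeds (g := val)) => x; rewrite in_inter_submod.
Qed.

(** The hypothesis on [kdim_lt] is what [kdim_lt_embeds] proves by induction on
    the ordinal, through the present lemma at smaller ordinals. *)
Lemma kdim_chain_embeds alpha U V :
    (forall U' V', embeds U' V' -> kdim_lt alpha V' -> kdim_lt alpha U') ->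
  embeds U V -> kdim_chain alpha V -> kdim_chain alpha U.
Proof.
move=> ltS [f injf] cV N Ndown.
have /choice[N' N'E] i := image_exists f (N i).
have [|m mP] := cV N'.
  by move=> i _ /N'E[x xN ->]; apply/N'E; exists x => //; apply: Ndown.
exists m => i /mP; apply: ltS.
have [|g gE] := @linear_to_submod _ _ (f \o val : {linear submod (N i) -> V}) (N' i).
  by move=> x; apply/N'E; exists (val x); rewrite ?(valP x).
apply: (quotm_comp_embeds (g := g)) => x; rewrite !in_inter_submod gE /=.
apply/idP/idP => [xN|/N'E[y yN /injf ->]] //.
by apply/N'E; exists (val x).
Qed.

Lemma kdim_lt_embeds alpha U V :
  embeds U V -> kdim_lt alpha V -> kdim_lt alpha U.
Proof.
elim: (olt_wf alpha) U V => {}alpha _ IH U V eUV [V0|[beta ba /kdimP[_ cV]]].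
  by left=> U0; apply/V0/(nonzero_embeds eUV).
by apply: (kdim_chain_lt ba); apply: kdim_chain_embeds (IH _ ba) eUV cV.
Qed.

(** Noetherian induction on the kernel N of a factor Q of M. If all factors by
    larger kernels have a Krull dimension, let [Ord a] exceed all of these.
    In a descending chain C of Q with no zero term, C_i / C_i+1 embeds in
    Q / C_i+1, a factor by a larger kernel; so Q satisfies the chain
    condition at [Ord a]. Speaking of all surjections with kernel N, instead of
    the quotient by N only, lets Q / C_i+1 count directly as a factor of M. *)
Lemma noetherian_kdim M : noetherian M -> exists alpha, kdim_lt alpha M.
Proof.
move=> noeM.
pose bounded (N : submodClosed M) (alpha : ord) :=
  forall (Q : lmodType R) (f : {linear M -> Q}),
  (forall q, exists x, q = f x) -> (forall x, x \in N <-> f x = 0) ->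
  kdim_lt alpha Q.
suff allN N : exists alpha, bounded N alpha.
  have [Z ZE] := zero_submod_exists M; have [alpha bZ] := allN Z.
  by exists alpha; apply: (bZ _ idfun) => // q; exists q.
apply: contrapT => unbN.
have [{unbN} N' unbN Nmax] :=
  noetherian_max noeM (F := fun N => ~ exists alpha, bounded N alpha) unbN.
have /choice[a aP] (L : submodClosed M) : exists alpha,
    {subset N' <= L} -> ~ {subset L <= N'} -> bounded L alpha.
  have [[NL nLN]|nL] := EM ({subset N' <= L} /\ ~ {subset L <= N'}).
    suff [alpha bL] : exists alpha, bounded L alpha by exists alpha.
    by apply: contrapT => nbL; apply/nLN/Nmax.
  (* junk value on the kernels that are not larger *)
  by exists (Ord (fun i : void => match i with end)) => NL nLN; case: nL.
apply: unbN; exists (Ord (fun _ : unit => Ord a)) => Q f fS fK.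
apply: (@kdim_chain_lt _ (Ord a)); first by exists tt; apply: ole_refl.
move=> C Cdown; have [[m Cm0]|Cn0] := EM (exists m, ~ nonzero_submod (C m)).
  exists m => i le_mi; left=> -[q]; have [x ->] := quotm_projK q; case/negP.
  rewrite quotm_proj_eq0 in_inter_submod.
  suff -> : val x = 0 by rewrite rpred0.
  apply: contrapT => /eqP x0; apply: Cm0; exists (val x) => //.
  have Cdesc k y : y \in C (k + m)%N -> y \in C m.
    by elim: k => [|k IH] // /Cdown/IH.
  by apply: (Cdesc (i - m)%N); rewrite subnK //; apply: valP.
exists 0%N => i _; apply: kdim_lt_embeds (@quotm_chain_embeds _ _ _) _.
have [L LE] := preimage_exists f (C i.+1).
apply: (kdim_lt_ole (ole_Ord a L)).
apply: (aP L _ _ _ (quotm_proj (C i.+1) \o f)) => [x xN'|LN'|q|x].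
- by rewrite LE; move/fK: xN' => ->; rewrite rpred0.
- apply: Cn0; exists i.+1 => -[q qC /eqP]; apply.
  have [x qx] := fS q; rewrite qx; apply/fK/LN'.
  by rewrite LE -qx.
- have [y ->] := quotm_projK q; have [x ->] := fS y.
  by exists x.
- by rewrite /= LE -quotm_proj_eq0; split=> [/eqP|->].
Qed.

(** * Critical submodules *)

(** Nonzero submodules of a critical module are critical, but that uses the
    additivity of Krull dimension along extensions. Asking for the property
    from the start avoids it: submodules of minimal dimension enjoy it. *)
Definition hereditarily_critical (alpha : ord) M : Prop :=
  forall V, nonzero_mod V -> embeds V M -> alpha_critical alpha V.

(** If every nonzero N had a nonzero L inside with N/L not of dimension below
    alpha, iterating would give a chain violating the chain condition. *)
Lemma critical_submodule alpha M :
    nonzero_mod M -> kdim_chain alpha M ->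
    (forall V, nonzero_mod V -> embeds V M -> ~ kdim_lt alpha V) ->
  exists N : submodClosed M, nonzero_submod N /\
    forall L : submodClosed M, nonzero_submod L -> {subset L <= N} ->
      kdim_lt alpha (quotm (inter_submod (N:=N) L)).
Proof.
move=> [x0 x00] cM minM; apply: contrapT => nocrit.
have step (N : {N : submodClosed M | nonzero_submod N}) :
    exists L : {L : submodClosed M | nonzero_submod L},
      {subset sval L <= sval N}
      /\ ~ kdim_lt alpha (quotm (inter_submod (N:=sval N) (sval L))).
  case: N => N N0 /=; apply: contrapT => none; apply: nocrit; exists N; split=> // L L0 LN.
  by apply: contrapT => nlt; apply: none; exists (exist _ L L0).
have [s sP] := choice step.
have [T TE] : exists T : submodClosed M, forall y, y \in T <-> True.
  by apply: submod_exists.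
have T0 : nonzero_submod T by exists x0 => //; apply/TE.
pose c i := iter i s (exist _ T T0).
have [|m /(_ m (leqnn m))] := cM (fun i => sval (c i)).
  by move=> i; case: (sP (c i)).
by case: (sP (c m)).
Qed.

(** For V inside N and K inside V, the factor V/K embeds in N/K, of dimension
    below alpha; and V has dimension exactly alpha, since it inherits the chain
    condition from M and the lower bound is the minimality hypothesis. *)
Lemma kdim_critical alpha M :
    nonzero_mod M -> kdim_chain alpha M ->
    (forall V, nonzero_mod V -> embeds V M -> ~ kdim_lt alpha V) ->
  exists2 N : submodClosed M, nonzero_submod N
    & hereditarily_critical alpha (submod N).
Proof.
move=> M0 cM minM; have [N [N0 Ncrit]] := critical_submodule M0 cM minM.
exists N => // V V0 eVN; have eVM := embeds_trans eVN (embeds_submod N).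
split.
  apply/kdimP; split; first exact: minM.
  by apply: kdim_chain_embeds eVM cM => U' V'; apply: kdim_lt_embeds.
move=> K [k kK k0]; case: eVN => f injf.
pose g : {linear V -> M} := val \o f; have [L LE] := image_exists g K.
have gN x : g x \in N := valP (f x).
have injg : injective g by move=> x y /val_inj/injf.
apply: (@kdim_lt_embeds _ _ (quotm (inter_submod (N:=N) L))).
  apply: (quotm_comp_embeds (g := f)) => x.
  rewrite in_inter_submod -[val (f x)]/(g x).
  by apply/idP/idP => [xK|/LE[y yK /injg ->]] //; apply/LE; exists x.
apply: Ncrit; last by move=> _ /LE[x _ ->].
exists (g k); first by apply/LE; exists k.
by apply: contraNneq k0 => gk0; apply/eqP/injg; rewrite gk0 raddf0.
Qed.

(** The previous lemma applies to a submodule whose dimension alpha is least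
    among the Krull dimensions of nonzero submodules of M. *)
Lemma noetherian_critical M :
    noetherian M -> nonzero_mod M ->
  exists (alpha : ord) (N : submodClosed M),
    nonzero_submod N /\ hereditarily_critical alpha (submod N).
Proof.
move=> noeM M0.
pose occurs alpha := exists W, [/\ nonzero_mod W, embeds W M & kdim alpha W].
have [a0 oa0] : exists a, occurs a.
  have [a [//|[b _ bM]]] := noetherian_kdim noeM.
  by exists b, M; split=> //; exists idfun.
have [a [W [W0 eWM /kdimP[_ cW]]] amin] :
    exists2 a, occurs a & forall b, olt b a -> ~ occurs b.
  apply: contrapT => nomin; elim: (olt_wf a0) oa0 => a _ IH oa.
  by apply: nomin; exists a.
have [||V V0 eVW|N [x xN x0] critN] := @kdim_critical a W => //.
  case=> [//|[b ba bV]]; apply: (amin b ba); exists V; split=> //.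
  exact: embeds_trans eWM.
case: (eWM) => f injf; have [L LE] := image_exists f N.
exists a, L; split.
  exists (f x); first by apply/LE; exists x.
  by apply: contraNneq x0 => fx0; apply/eqP/injf; rewrite fx0 raddf0.
move=> V V0 eVL; apply: critN => //; apply: embeds_trans eVL _.
apply/lmod_iso_embeds/lmod_iso_sym/(lmod_iso_image (f := f \o val)) => [y z|y].
  by move=> /injf/val_inj.
split=> [/LE[z zN ->]|[z ->]].
  by have [z' z'z] := submod_lift zN; exists z'; rewrite /= z'z.
by apply/LE; exists (val z); rewrite ?(valP z).
Qed.

(** The x of the lemma has maximal annihilator among the nonzero elements of a
    submodule N all of whose nonzero submodules are critical. Such an x exists
    even though R is not assumed Noetherian: above ann(x0) the left ideals
    ann(y) correspond to the submodules K y = ann(y) x0 of W, and W satisfies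
    the ascending chain condition. *)
Lemma quasi_prime_critical_cyclic W :
    noetherian W -> nonzero_mod W ->
  exists (x : W) (P : submodClosed R^o),
    [/\ x != 0, forall a : R, a \in P <-> a *: x = 0, quasi_prime P,
        critical (quotm P) & noetherian (quotm P)].
Proof.
move=> noeW W0; have [alpha [N [[x0 x0N x00] critN]]] := noetherian_critical noeW W0.
pose le (y z : W) := forall a : R, a *: y = 0 -> a *: z = 0.
have /choice[K KE] (y : W) : exists L : submodClosed W,
    forall v, v \in L <-> exists2 a : R, a *: y = 0 & v = a *: x0.
  apply: submod_exists => [|c _ _ [a ay ->] [b by0 ->]].
    by exists 0; rewrite scale0r.
  exists (c * a + b); last by rewrite scalerDl scalerA.
  by rewrite scalerDl -scalerA ay by0 scaler0 addr0.
pose F (L : submodClosed W) := exists y, [/\ y \in N, y != 0, le x0 y & L = K y].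
have [|_ [x [xN xn0 le0x ->]] Kmax] := noetherian_max (F := F) (N0 := K x0) noeW.
  by exists x0; split=> // a.
have xmax y : y \in N -> y != 0 -> le x y -> le y x.
  move=> yN y0 xy a ay.
  have /KE[b bx ab] : a *: x0 \in K x.
    apply: (Kmax (K y)); last by apply/KE; exists a.
      by exists y; split=> // b /le0x/xy.
    by move=> _ /KE[b bx ->]; apply/KE; exists b => //; apply: xy.
  have : (a - b) *: x0 = 0 by rewrite scalerBl ab subrr.
  by move/le0x; rewrite scalerBl bx subr0.
have [P PE] := ann_exists x.
have [|m mE] := @linear_exists R^o (submod N) (fun a : R => a *: (Sub x xN : submod N)).
  by move=> a b c; rewrite scalerDl -scalerA.
have ePN : embeds (quotm P) (submod N).
  apply: (quotm_embeds (g := m)) => a; rewrite mE PE.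
  by split=> [ax|/(congr1 val)//]; apply: val_inj.
exists x, P; split=> //.
- split; first by exists 1; apply/negP => /PE; rewrite scale1r => /eqP; apply/negP.
  (* if b x != 0 with b in B, then ann(b x) contains A, hence P, so it is P *)
  move=> A B _ _ AB PAB; have [BP|nBP] := EM {subset B <= P}; first by right.
  left=> a aA; apply/PE.
  have [b [bB bx0]] : exists b : R, b \in B /\ b *: x != 0.
    apply: contrapT => none; apply: nBP => b bB; apply/PE/eqP/negPn/negP => bx0.
    by apply: none; exists b.
  apply: (xmax (b *: x)) => //; first by rewrite rpredZ.
    move=> c cx; rewrite scalerA; apply/PE/AB; exists 1%N, (fun=> c), (fun=> b).
    by rewrite big_ord1; split=> // _; have [] := PAB c ((PE c).2 cx).
  rewrite scalerA; apply/PE/AB; exists 1%N, (fun=> a), (fun=> b).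
  by rewrite big_ord1.
- exists alpha; apply: critN ePN.
  by exists (quotm_proj P 1); rewrite quotm_proj_eq0; apply/negP => /PE; rewrite scale1r => /eqP; apply/negP.
- exact: noetherian_embeds (embeds_trans ePN (embeds_submod N)) noeW.
Qed.

(** * Direct sums of cyclic modules *)

Lemma dsum_quotmK n (P : 'I_n -> submodClosed R^o)
    (q : dsum (fun i => quotm (P i))) :
  exists a : 'I_n -> R, forall i, q i = quotm_proj (P i) (a i).
Proof.
have /choice[a aE] i : exists a : R, q i = quotm_proj (P i) a.
  by have [a ->] := quotm_projK (q i); exists a.
by exists a.
Qed.

(** The maps R / P_i -> M sending the class of a to a x_i are injective, and
    independence of the x_i makes their sum injective. *)
Lemma dsum_cyclic_iso M n (x : 'I_n -> M) (P : 'I_n -> submodClosed R^o)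
    (S : submodClosed M) :
    (forall i (a : R), a \in P i <-> a *: x i = 0) -> cyclic_indep x ->
    (forall y, y \in S <-> exists a : 'I_n -> R, y = \sum_i a i *: x i) ->
  lmod_iso (dsum (fun i => quotm (P i))) (submod S).
Proof.
move=> PE indx SE.
have /choice[m mE] i : exists m : {linear R^o -> M}, forall a : R, m a = a *: x i.
  apply: (@linear_exists R^o M (fun a : R => a *: x i)) => a b c.
  by rewrite scalerDl -scalerA.
have hex i : exists h : {linear quotm (P i) -> M},
    forall a : R, h (quotm_proj (P i) a) = a *: x i.
  have [|h hE] := @quotm_factor _ _ (m i) (P i).
    by move=> a /PE; rewrite mE.
  by exists h => a; rewrite hE mE.
pose h i := projT1 (cid (hex i)).
have hE i (a : R) : h i (quotm_proj (P i) a) = a *: x i := projT2 (cid (hex i)) a.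
pose f0 (q : dsum (fun i => quotm (P i))) := \sum_i h i (q i).
have [|f fE] := @linear_exists _ M f0.
  move=> c p q; rewrite scaler_sumr -big_split; apply: eq_bigr => i _.
  by rewrite /= -linearP !ffunE.
apply: (@lmod_iso_image _ _ f) => [|y].
  apply: linear_inj0 => q; have [a aE] := dsum_quotmK q; rewrite fE => q0.
  apply/ffunP => i; rewrite [RHS]ffunE aE; apply/eqP; rewrite quotm_proj_eq0.
  apply/PE/indx; rewrite -[RHS]q0; apply: eq_bigr => j _.
  by rewrite aE hE.
split=> [/SE[a ->]|[q ->]].
  exists [ffun i => quotm_proj (P i) (a i)]; rewrite fE.
  by apply: eq_bigr => i _; rewrite ffunE hE.
have [a aE] := dsum_quotmK q; apply/SE; exists a; rewrite fE; apply: eq_bigr => i _.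
by rewrite aE hE.
Qed.

Lemma fg_dsum_cyclic n (P : 'I_n -> submodClosed R^o) :
  finitely_generated (dsum (fun i => quotm (P i))).
Proof.
pose e (i : 'I_n) : dsum (fun i => quotm (P i)) :=
  [ffun j => quotm_proj (P j) (i == j)%:R].
exists n, e => q.
have [a aE] := dsum_quotmK q; exists a; apply/ffunP => j.
pose coord (p : dsum (fun i => quotm (P i))) := p j.
have [|c cE] := @linear_exists _ _ coord; first by move=> b p r; rewrite /coord !ffunE.
transitivity (c (\sum_i a i *: e i)); last by rewrite cE.
rewrite aE linear_sum.
rewrite (bigD1 j) //= linearZ cE /coord ffunE eqxx -linearZ /= big1 ?addr0 => [|i /negPf ij].
  by congr (quotm_proj _ _); rewrite [RHS]mulr1.
by rewrite linearZ cE /coord ffunE ij /= raddf0; apply: scaler0.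
Qed.

Lemma essential_span M n (U : 'I_n -> submodClosed M) (x : 'I_n -> M) :
    (forall i, uniform (submod (U i))) -> independent U ->
    essential (sum_submod U) -> (forall i, x i \in U i) -> (forall i, x i != 0) ->
  exists S : submodClosed M, [/\ essential S, cyclic_indep x
    & forall y, y \in S <-> exists a : 'I_n -> R, y = \sum_i a i *: x i].
Proof.
move=> uniU indU essU xU x0.
have [S SE] := lincomb_exists x predT; exists S; split=> //.
  apply: essential_meets essU _ => // i; exists (x i); split=> //.
  apply/SE; exists (fun j => (j == i)%:R).
  rewrite (bigD1 i) //= eqxx scale1r big1 ?addr0 // => j /negPf->.
  by rewrite scale0r.
by move=> a sum0; apply: (indU (fun i => a i *: x i)) => // i; rewrite rpredZ.
Qed.

Lemma vss_fg_noetherian M :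
  virtually_semisimple M -> finitely_generated M -> noetherian M.
Proof.
move=> vssM fgM; apply: all_fg_noetherian => N.
have [K sumK isoNK] := vssM N.
exact: fg_iso (lmod_iso_sym isoNK) (fg_summand sumK fgM).
Qed.

(** M is isomorphic to the essential submodule spanned by one nonzero element
    of each U i. *)
Lemma vss_udim_fg M :
  virtually_semisimple M -> udim_finite M -> finitely_generated M.
Proof.
move=> vssM udM; have [n [U [uniU indU essU]]] := udM.
have /choice[x xP] i : exists x, x \in U i /\ x != 0.
  by have [[u uU u0] _] := (uniformP (U i)).1 (uniU i); exists u.
have [|| S [essS indx SE]] := @essential_span _ _ U x uniU indU essU.
- by move=> i; case: (xP i).
- by move=> i; case: (xP i).
apply: fg_iso (lmod_iso_sym (vss_essential vssM udM essS)) _.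
have /choice[y yE] i : exists y : submod S, val y = x i.
  apply: submod_lift; apply/SE; exists (fun j => (j == i)%:R).
  rewrite (bigD1 i) //= eqxx scale1r big1 ?addr0 // => j /negPf->.
  by rewrite scale0r.
exists n, y => z; have /SE[a zE] := valP z; exists a; apply: val_inj.
by rewrite val_lincomb [LHS]zE; apply: eq_bigr => i _; rewrite yE.
Qed.

(** The same isomorphism, for elements of the U i chosen with quasi prime
    annihilator and critical span. *)
Lemma vss_udim_decomposition M :
    virtually_semisimple M -> noetherian M -> udim_finite M ->
  exists n (P : 'I_n -> submodClosed R^o),
    (forall i, [/\ quasi_prime (P i), critical (quotm (P i))
                 & noetherian (quotm (P i))])
    /\ lmod_iso M (dsum (fun i => quotm (P i))).
Proof.
move=> vssM noeM udM; have [n [U [uniU indU essU]]] := udM.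
have /choice[x xP] i : exists x : M, [/\ x \in U i, x != 0
    & exists P : submodClosed R^o, (forall a : R, a \in P <-> a *: x = 0) /\
        [/\ quasi_prime P, critical (quotm P) & noetherian (quotm P)]].
  have noeU := noetherian_embeds (embeds_submod (U i)) noeM.
  have [x [P [x0 PE qP cP nP]]] := quasi_prime_critical_cyclic noeU (uniU i).1.
  exists (val x); split; [exact: valP | by rewrite -(inj_eq val_inj) in x0 |].
  exists P; split=> // a; rewrite PE.
  by split=> [/(congr1 val)//|ax]; apply: val_inj.
have /choice[P PP] i : exists P : submodClosed R^o,
    (forall a : R, a \in P <-> a *: x i = 0) /\
    [/\ quasi_prime P, critical (quotm P) & noetherian (quotm P)].
  by case: (xP i).
exists n, P; split=> [i|]; first by case: (PP i).
have xU i : x i \in U i by case: (xP i).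
have x0 i : x i != 0 by case: (xP i).
have [S [essS indx SE]] := essential_span uniU indU essU xU x0.
apply: lmod_iso_trans (vss_essential vssM udM essS) (lmod_iso_sym _).
by apply: dsum_cyclic_iso indx SE => i; case: (PP i).
Qed.

End Modules.

Theorem proposition2p7 (R : pzRingType) (M : lmodType R)
    (M_neq0 : nonzero_mod M) (vssM : virtually_semisimple M) :
  let cond4 :=
    exists n (P : 'I_n -> submodClosed R^o),
      (forall i, [/\ quasi_prime (P i), critical (quotm (P i))
                   & noetherian (quotm (P i))])
      /\ lmod_iso M (dsum (fun i => quotm (P i))) in
  [<-> finitely_generated M; noetherian M; udim_finite M; cond4]
  /\ (finitely_generated M \/ noetherian M \/ udim_finite M \/ cond4 ->
      forall N : submodClosed M, essential N -> lmod_iso M (submod N)).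
Proof.
move=> cond4.
have fg_noe := vss_fg_noetherian vssM.
have ud_fg := vss_udim_fg vssM.
have c4_fg : cond4 -> finitely_generated M.
  move=> [n [P [_ isoM]]].
  exact: fg_iso (lmod_iso_sym isoM) (fg_dsum_cyclic P).
split.
  split; [|split; [|split]] => //.
  - exact: noetherian_udim.
  - by move=> udM; apply: vss_udim_decomposition => //; apply/fg_noe/ud_fg.
move=> any N essN; apply: vss_essential => //.
case: any => [/fg_noe/noetherian_udim|[/noetherian_udim|[|]]] //.
by move/c4_fg/fg_noe/noetherian_udim.
Qed.
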